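(* Let $\lambda\in\mathfrak h^*$ be an atypical and non-integral weight. Then the group $W_\lambda^1$ is isomorphic to one of $$\{e\},\quad \mathbb Z_2,\quad \mathbb Z_2\times\mathbb Z_2,\quad S_3,\quad D_{12},$$ where $S_3$ is the symmetric group in $3$ letters and $D_{12}$ is the dihedral group of order $12$. Furthermore: (1) $W_\lambda^1=\{e\}$ if and only if $W_\lambda=\{e\}$. (2) $W_\lambda^1\cong\mathbb Z_2$ if and only if $W_\lambda^1$ is one of $\langle s_{\epsilon_2-\epsilon_1}\rangle$, $\langle s_{\epsilon_1}\rangle$, $\langle s_{\epsilon_1-\epsilon_3}\rangle$, $\langle s_{-\epsilon_3}\rangle$, $\langle s_{\epsilon_2-\epsilon_3}\rangle$, $\langle s_{\epsilon_2}\rangle$. (3) $W_\lambda^1\cong\mathbb Z_2\times\mathbb Z_2$ if and only if $W_\lambda^1$ is one of $\langle s_{-\epsilon_3},s_{\epsilon_2-\epsilon_1}\rangle$, $\langle s_{\epsilon_1},s_{\epsilon_2-\epsilon_3}\rangle$, $\langle s_{\epsilon_2},s_{\epsilon_1-\epsilon_3}\rangle$. (4) $W_\lambda^1\cong S_3$ if and only if $W_\lambda^1=\langle s_{\epsilon_1},s_{\epsilon_2},s_{-\epsilon_3}\rangle$. (5) $W_\lambda^1=W_{G_2}\cong D_{12}$ if and only if $W_\lambda=W_{G_2}$.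
   Context: Consider the root system of the exceptional Lie superalgebra $G(3)$. Let $\mathfrak h^*=\mathbb C\delta\oplus\mathbb C\epsilon_1\oplus\mathbb C\epsilon_2$, $\epsilon_3=-\epsilon_1-\epsilon_2$, with symmetric bilinear form $(\delta,\delta)=-2$, $(\epsilon_i,\epsilon_i)=2$, $(\epsilon_i,\epsilon_j)=-1$ for $i\neq j$, $(\delta,\epsilon_i)=0$. The positive even roots are $\Phi_{\bar0}^+=\{2\delta\}\cup\Phi^+_{\bar0,\circ}$ with $\Phi^+_{\bar0,\circ}=\{\epsilon_1,\epsilon_2,-\epsilon_3,\epsilon_2-\epsilon_1,\epsilon_1-\epsilon_3,\epsilon_2-\epsilon_3\}$, and $\Phi_{\bar0}=\Phi_{\bar0}^+\cup(-\Phi_{\bar0}^+)$; the positive isotropic odd roots are $\Phi^+_{\bar1,\otimes}=\{\delta\pm\epsilon_i: i=1,2,3\}$. The Weyl vector is $\rho=-\frac52\delta+2\epsilon_1+3\epsilon_2$. For $\alpha\in\Phi_{\bar0}$ put $\langle\lambda,\alpha^\vee\rangle=2(\lambda,\alpha)/(\alpha,\alpha)$ and $s_\alpha\lambda=\lambda-\langle\lambda,\alpha^\vee\rangle\alpha$. Let $s_0=s_{2\delta}$, $s_1=s_{\epsilon_2-\epsilon_1}$, $s_2=s_{\epsilon_1}$; $W_{G_2}=\langle s_1,s_2\rangle$ and $W=\langle s_0\rangle\times W_{G_2}$. For $\lambda\in\mathfrak h^*$: $\lambda$ is atypical if $A(\lambda)=\{\alpha\in\Phi^+_{\bar1,\otimes}:(\lambda,\alpha)=0\}$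 is non-empty. For $\gamma\in\Phi_{\bar0}$, $\lambda$ is $\gamma$-integral if $\langle\lambda-\rho,\gamma^\vee\rangle\in\mathbb Z$ (i.e. $\langle\lambda,\gamma^\vee\rangle\in\mathbb Z$ if $\gamma\ne\pm2\delta$, and $\in\frac12+\mathbb Z$ if $\gamma=\pm2\delta$); $\lambda$ is non-integral if it is not $\gamma$-integral for some $\gamma\in\Phi_{\bar0}^+$. The integral Weyl group is $W_\lambda=\langle s_\gamma:\gamma\in\Phi_{\bar0},\ \lambda\text{ is }\gamma\text{-integral}\rangle$; it decomposes as $W_\lambda=W_\lambda^0\times W_\lambda^1$ with $W_\lambda^0\subseteq\langle s_0\rangle$ and $W_\lambda^1\subseteq W_{G_2}$. *)

(* Defs.v *)
From HB Require Import structures.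
From mathcomp Require Import all_boot all_order all_algebra all_fingroup all_solvable.
From mathcomp Require Import boolp classical_sets functions reals.
From mathcomp Require Import complex.
From mathcomp Require Import ring.

Set Implicit Arguments.
Unset Strict Implicit.
Unset Printing Implicit Defensive.

Import GRing.Theory Num.Theory.

Local Open Scope classical_set_scope.
Local Open Scope ring_scope.

(* Groups of bijections of T, the group law being composition. *)
Definition is_group (T : Type) (G : set (T -> T)) : Prop :=
  [/\ G id,
      forall f g, G f -> G g -> G (f \o g) &
      forall f, G f -> exists g, [/\ G g, cancel f g & cancel g f]].

(* The subgroup generated by S.  It is meant for sets S of bijections: otherwise
   no group contains S and the intersection below is everything. *)
Definition gen (T : Type) (S : set (T -> T)) : set (T -> T) :=
  smallest (@is_group T) S.

Definition group_iso (T : Type) (G : set (T -> T))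
    (gT : finGroupType) (H : {set gT}) : Prop :=
  exists f : (T -> T) -> gT,
    set_bij G [set` H] f /\
    (forall x y, G x -> G y -> f (x \o y) = (f x * f y)%g).

(* h^* is the space of row vectors over R[i], in the basis (delta, eps1, eps2). *)
Notation hstar R := 'rV[R[i]%C]_3.

Definition delta (R : realType) : hstar R := delta_mx 0 0.
Definition eps1 (R : realType) : hstar R := delta_mx 0 1.
Definition eps2 (R : realType) : hstar R := delta_mx 0 2.
Definition eps3 (R : realType) : hstar R := - eps1 R - eps2 R.

Arguments delta {R}.
Arguments eps1 {R}.
Arguments eps2 {R}.
Arguments eps3 {R}.

Definition form (R : realType) (u v : hstar R) : R[i]%C :=
  - 2 * (u 0 0 * v 0 0) + 2 * (u 0 1 * v 0 1) + 2 * (u 0 2 * v 0 2)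
  - (u 0 1 * v 0 2 + u 0 2 * v 0 1).

Definition pos_even_circ (R : realType) : seq (hstar R) :=
  [:: eps1; eps2; - eps3; eps2 - eps1; eps1 - eps3; eps2 - eps3].

Definition pos_even (R : realType) : seq (hstar R) :=
  2 *: delta :: pos_even_circ R.

Definition even_roots (R : realType) : seq (hstar R) :=
  pos_even R ++ [seq - a | a <- pos_even R].

Definition pos_odd_iso (R : realType) : seq (hstar R) :=
  [:: delta + eps1; delta - eps1; delta + eps2; delta - eps2;
      delta + eps3; delta - eps3].

Definition rho (R : realType) : hstar R :=
  - (5 / 2) *: delta + 2 *: eps1 + 3 *: eps2.

Definition copair (R : realType) (lam alpha : hstar R) : R[i]%C :=
  2 * form lam alpha / form alpha alpha.

Definition refl (R : realType) (alpha lam : hstar R) : hstar R :=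
  lam - copair lam alpha *: alpha.

Definition atyp_roots (R : realType) (lam : hstar R) : set (hstar R) :=
  [set alpha | alpha \in pos_odd_iso R /\ form lam alpha = 0].

Definition atypical (R : realType) (lam : hstar R) : Prop :=
  atyp_roots lam !=set0.

Definition integral_at (R : realType) (gamma lam : hstar R) : Prop :=
  exists m : int, copair (lam - rho R) gamma = m%:~R.

Definition nonintegral (R : realType) (lam : hstar R) : Prop :=
  exists2 gamma, gamma \in pos_even R & ~ integral_at gamma lam.

Definition W0 (R : realType) : set (hstar R -> hstar R) :=
  gen [set refl (2 *: delta)].

Definition WG2 (R : realType) : set (hstar R -> hstar R) :=
  gen [set refl (eps2 - eps1); refl eps1].

Arguments W0 R : clear implicits.
Arguments WG2 R : clear implicits.

Definition Wint (R : realType) (lam : hstar R) : set (hstar R -> hstar R) :=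
  gen [set s | exists gamma,
    [/\ gamma \in even_roots R, integral_at gamma lam & s = refl gamma]].

(* The two factors of the integral Weyl group are its intersections with <s_0>
   and W_{G_2}; Wint_prod, W0_WG2_comm and W0_WG2_triv below show that it is
   their internal direct product. *)
Definition Wint0 (R : realType) (lam : hstar R) : set (hstar R -> hstar R) :=
  Wint lam `&` W0 R.

Definition Wint1 (R : realType) (lam : hstar R) : set (hstar R -> hstar R) :=
  Wint lam `&` WG2 R.

Lemma gen_sub (T : Type) (S G : set (T -> T)) :
  is_group G -> S `<=` G -> gen S `<=` G.
Proof. by move=> Ggrp SG; apply: smallest_sub. Qed.

Lemma sub_gen (T : Type) (S : set (T -> T)) : S `<=` gen S.
Proof. exact: sub_gen_smallest. Qed.

Lemma gen_group (T : Type) (S : set (T -> T)) :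
  (forall s, S s -> cancel s s) -> is_group (gen S).
Proof.
move=> invS.
have bijG : is_group [set f : T -> T | exists g, cancel f g /\ cancel g f].
  split.
  - by exists id.
  - move=> f g [f' [ff' f'f]] [g' [gg' g'g]]; exists (g' \o f').
    by split=> x /=; rewrite ?ff' ?gg' ?g'g ?f'f.
  - by move=> f [g [fg gf]]; exists g; split=> //; exists f.
have SG : S `<=` [set f : T -> T | exists g, cancel f g /\ cancel g f].
  by move=> s /invS ss; exists s.
split.
- by move=> H [[]].
- move=> f g fS gS H [Hgrp SH]; case: (Hgrp) => _ mulH _.
  by apply: mulH; [apply: fS | apply: gS].
- move=> f fS; have [g [fg gf]] := fS _ (conj bijG SG).
  exists g; split=> // H [Hgrp SH].
  case: (Hgrp) => _ _ /(_ _ (fS H (conj Hgrp SH))) [h [Hh fh hf]].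
  suff -> : g = h by [].
  by apply: funext => x; rewrite -{1}[x]hf fg.
Qed.

Definition coord_row (R : realType) (a b c : R[i]%C) : hstar R :=
  a *: delta + b *: eps1 + c *: eps2.

Lemma coord_rowE (R : realType) (a b c : R[i]%C) :
  ((coord_row a b c 0 0 = a) * (coord_row a b c 0 1 = b) *
   (coord_row a b c 0 2 = c)).
Proof. by do !split; rewrite !mxE /=; ring. Qed.

Lemma eq_hstar (R : realType) (u v : hstar R) :
  u 0 0 = v 0 0 -> u 0 1 = v 0 1 -> u 0 2 = v 0 2 -> u = v.
Proof.
move=> e0 e1 e2; apply/rowP => j.
have [-> // | j0] := eqVneq j 0; have [-> // | j1] := eqVneq j 1.
suff -> : j = 2 by [].
by apply: val_inj; case: j j0 j1 => [[|[|[|]]]].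
Qed.

Lemma hstarE (R : realType) (v : hstar R) :
  v = coord_row (v 0 0) (v 0 1) (v 0 2).
Proof. by apply: eq_hstar; rewrite coord_rowE. Qed.

Lemma copair_even (R : realType) (v : hstar R) :
  ((copair v (2 *: delta) = v 0 0) *
   (copair v eps1 = 2 * v 0 1 - v 0 2) *
   (copair v eps2 = 2 * v 0 2 - v 0 1) *
   (copair v (- eps3) = v 0 1 + v 0 2) *
   (copair v (eps2 - eps1) = v 0 2 - v 0 1) *
   (copair v (eps1 - eps3) = v 0 1) *
   (copair v (eps2 - eps3) = v 0 2)).
Proof.
by do !split; rewrite /copair /form /eps3 /delta /eps1 /eps2 !mxE /=; field.
Qed.

Lemma even_reflE (R : realType) (a b c : R[i]%C) :
  ((refl (2 *: delta) (coord_row a b c) = coord_row (- a) b c) *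
   (refl eps1 (coord_row a b c) = coord_row a (c - b) c) *
   (refl eps2 (coord_row a b c) = coord_row a b (b - c)) *
   (refl (- eps3) (coord_row a b c) = coord_row a (- c) (- b)) *
   (refl (eps2 - eps1) (coord_row a b c) = coord_row a c b) *
   (refl (eps1 - eps3) (coord_row a b c) = coord_row a (- b) (c - b)) *
   (refl (eps2 - eps3) (coord_row a b c) = coord_row a (b - c) (- c))).
Proof.
by do !split; apply: eq_hstar;
  rewrite [LHS]mxE [X in _ + X]mxE [X in _ - X]mxE copair_even !coord_rowE;
  rewrite /eps3 /delta /eps1 /eps2 !mxE /=; ring.
Qed.

Lemma reflN (R : realType) (al : hstar R) : refl (- al) = refl al.
Proof.
apply: funext => v; rewrite /refl; suff -> : copair v (- al) = - copair v al.
  by rewrite scalerN scaleNr opprK.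
rewrite /copair /form !mxE -mulNr; congr (_ / _); ring.
Qed.

Local Ltac coords := apply: funext; let v := fresh in intro v;
  rewrite /= [v]hstarE !even_reflE; congr coord_row; ring.

Lemma refl_words (R : realType) :
  (refl eps2 = refl (eps2 - eps1) \o refl eps1 \o refl (eps2 - eps1)
     :> (hstar R -> hstar R)) *
  (refl (- eps3) = refl eps1 \o refl eps2 \o refl eps1
     :> (hstar R -> hstar R)) *
  (refl (eps1 - eps3) = refl eps1 \o refl (eps2 - eps1) \o refl eps1
     :> (hstar R -> hstar R)) *
  (refl (eps2 - eps3) =
     refl (eps2 - eps1) \o refl (eps1 - eps3) \o refl (eps2 - eps1)
     :> (hstar R -> hstar R)).
Proof. by do !split; coords. Qed.

Lemma refl2 (R : realType) (al : hstar R) :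
  al \in even_roots R -> cancel (refl al) (refl al).
Proof.
have rr (b : hstar R) : refl b \o refl b = id -> cancel (refl b) (refl b).
  by move=> e v; rewrite -[RHS]/(id v) -e.
have pos b : b \in pos_even R -> cancel (refl b) (refl b).
  rewrite !inE; do 6![case/predU1P => [->|]; first by apply: rr; coords].
  by move/eqP=> ->; apply: rr; coords.
by rewrite mem_cat => /orP[/pos //|/mapP[b /pos bb ->]]; rewrite reflN.
Qed.

Lemma W0_group (R : realType) : is_group (W0 R).
Proof.
by apply: gen_group => s /= ->; apply: refl2; rewrite !inE eqxx.
Qed.

Lemma WG2_group (R : realType) : is_group (WG2 R).
Proof.
by apply: gen_group => s /= [] ->; apply: refl2; rewrite !inE eqxx ?orbT.
Qed.

Lemma Wint_group (R : realType) (lam : hstar R) : is_group (Wint lam).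
Proof. by apply: gen_group => s [gamma [gr _ ->]]; apply: refl2. Qed.

Lemma even_refl (R : realType) (gamma : hstar R) :
  gamma \in even_roots R -> W0 R (refl gamma) \/ WG2 R (refl gamma).
Proof.
have [_ mulW _] := WG2_group R.
have W1 : WG2 R (refl (eps2 - eps1)) by apply: sub_gen; left.
have W2 : WG2 R (refl eps1) by apply: sub_gen; right.
have conjW f g : WG2 R f -> WG2 R g -> WG2 R (f \o g \o f).
  by move=> fW gW; apply: (mulW _ _ (mulW _ _ fW gW) fW).
have W3 : WG2 R (refl eps2) by rewrite refl_words; apply: conjW.
have W4 : WG2 R (refl (- eps3)) by rewrite refl_words; apply: conjW.
have W5 : WG2 R (refl (eps1 - eps3)) by rewrite refl_words; apply: conjW.
have W6 : WG2 R (refl (eps2 - eps3)) by rewrite refl_words; apply: conjW.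
have W7 : W0 R (refl (2 *: delta)) by apply: sub_gen.
have posW al : al \in pos_even R -> W0 R (refl al) \/ WG2 R (refl al).
  rewrite !inE => /predU1P[->|al_in]; [by left | right]; move: al_in.
  case/predU1P=> [->|]; first exact: W2.
  case/predU1P=> [->|]; first exact: W3.
  case/predU1P=> [->|]; first exact: W4.
  case/predU1P=> [->|]; first exact: W1.
  by case/predU1P=> [->|/eqP ->]; [exact: W5 | exact: W6].
by rewrite mem_cat => /orP[/posW //|/mapP[al /posW alW ->]]; rewrite reflN.
Qed.

Lemma W0_WG2_comm (R : realType) (a b : hstar R -> hstar R) :
  W0 R a -> WG2 R b -> a \o b = b \o a.
Proof.
have cent (c : hstar R -> hstar R) :
    is_group [set f : hstar R -> hstar R |
      (exists g, cancel f g /\ cancel g f) /\ f \o c = c \o f].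
  split=> /=.
  - by split=> //; exists id.
  - move=> f g [[f' [ff' f'f]] fc] [[g' [gg' g'g]] gc]; split.
      by exists (g' \o f'); split=> x /=; rewrite ?ff' ?gg' ?g'g ?f'f.
    by rewrite -compA gc compA fc.
  - move=> f [[g [fg gf]] fc]; exists g; split=> //; split; first by exists f.
    apply: funext => x /=; rewrite -{1}[x]gf.
    by have /(congr1 (fun h => h (g x))) /= <- := fc; rewrite fg.
have bij (al : hstar R) : al \in even_roots R ->
    exists g, cancel (refl al) g /\ cancel g (refl al).
  by move=> /refl2 rr; exists (refl al).
move=> Wa Wb; suff [_ ->] : [set f : hstar R -> hstar R |
      (exists g, cancel f g /\ cancel g f) /\ f \o b = b \o f] a by [].
apply: (gen_sub (cent b)) Wa => _ /= -> /=.
split; first by apply: bij; rewrite !inE eqxx.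
suff [_ ->] : [set f : hstar R -> hstar R |
      (exists g, cancel f g /\ cancel g f) /\
      f \o refl (2 *: delta) = refl (2 *: delta) \o f] b by [].
apply: (gen_sub (cent _)) Wb => _ /= [] -> /=; split.
- by apply: bij; rewrite !inE eqxx ?orbT.
- by coords.
- by apply: bij; rewrite !inE eqxx ?orbT.
- by coords.
Qed.

Lemma W0_WG2_triv (R : realType) : W0 R `&` WG2 R = [set id].
Proof.
have s0E (f : hstar R -> hstar R) :
    W0 R f -> f = id \/ f = refl (2 *: delta).
  have ss : refl (2 *: delta) \o refl (2 *: delta) = id :> (hstar R -> hstar R).
    by coords.
  have grp : is_group [set f : hstar R -> hstar R |
      f = id \/ f = refl (2 *: delta)].
    split=> /=; first by left.
    - by move=> ? ? [->|->] [->|->]; rewrite ?ss; auto.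
    - move=> ? [->|->]; first by exists id; split=> //; left.
      exists (refl (2 *: delta)); split; first by right.
        by move=> v; rewrite -[RHS]/(id v) -ss.
      by move=> v; rewrite -[RHS]/(id v) -ss.
  by move=> fW; apply: (gen_sub grp) fW => _ /= ->; right.
have fixd (f : hstar R -> hstar R) : WG2 R f -> forall v, f v 0 0 = v 0 0.
  have grp : is_group [set f : hstar R -> hstar R |
      (exists g, cancel f g /\ cancel g f) /\ forall v, f v 0 0 = v 0 0].
    split=> /=.
    - by split=> //; exists id.
    - move=> g h [[g' [gg' g'g]] gE] [[h' [hh' h'h]] hE]; split.
        by exists (h' \o g'); split=> x /=; rewrite ?gg' ?hh' ?h'h ?g'g.
      by move=> v; rewrite /= gE hE.
    - move=> g [[h [gh hg]] gE]; exists h; split=> //; split; first by exists g.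
      by move=> v; rewrite -[in RHS](hg v) gE.
  move=> fW; suff [_ fE] : [set f : hstar R -> hstar R |
      (exists g, cancel f g /\ cancel g f) /\ forall v, f v 0 0 = v 0 0] f by [].
  apply: (gen_sub grp) fW => _ /= [] -> /=; (split;
    first by eexists; split; apply: refl2; rewrite !inE eqxx ?orbT);
    by move=> v; rewrite [v]hstarE even_reflE !coord_rowE.
apply/seteqP; split=> [f [/s0E [-> //|->] /fixd /(_ (coord_row 1 0 0))]|f ->].
  rewrite even_reflE !(coord_rowE _ _ _).1.1 => /eqP.
  by rewrite -subr_eq0 -opprD oppr_eq0 -mulr2n pnatr_eq0.
by split; [case: (W0_group R) | case: (WG2_group R)].
Qed.

Lemma Wint_prod (R : realType) (lam : hstar R) :
  Wint lam = [set a \o b | a in Wint0 lam & b in Wint1 lam].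
Proof.
have [id0 mul0 inv0] := W0_group R; have [id1 mul1 inv1] := WG2_group R.
have [idW mulW invW] := Wint_group lam.
apply/seteqP; split=> [f fW|_ [a [aW _]] [b [bW _] <-]]; last exact: mulW.
have comm (a b : hstar R -> hstar R) x : W0 R a -> WG2 R b -> a (b x) = b (a x).
  by move=> a0 b1; rewrite -[LHS]/((a \o b) x) (W0_WG2_comm a0 b1).
have inv_uniq (g h k : hstar R -> hstar R) : cancel g h -> cancel k g -> h = k.
  by move=> gh kg; apply: funext => x; rewrite -{1}[x]kg gh.
have grp : is_group [set a \o b | a in Wint0 lam & b in Wint1 lam].
  split.
  - by exists id => //; exists id.
  - move=> _ _ [a [aW a0]] [b [bW b1] <-] [a' [aW' a0']] [b' [bW' b1'] <-].
    exists (a \o a'); first by split; [apply: mulW | apply: mul0].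
    exists (b \o b'); first by split; [apply: mulW | apply: mul1].
    by apply: funext => x /=; rewrite (comm _ _ _ a0' b1).
  - move=> _ [a [aW a0]] [b [bW b1] <-].
    have [c [cW ac ca]] := invW _ aW; have [c' [c0 ac' ca']] := inv0 _ a0.
    have [d [dW bd db]] := invW _ bW; have [d' [d1 bd' db']] := inv1 _ b1.
    have ec := inv_uniq _ _ _ ac ca'; have ed := inv_uniq _ _ _ bd db'.
    subst c' d'; exists (c \o d); split.
    + by exists c => //; exists d.
    + by move=> x /=; rewrite -(comm _ _ _ a0 d1) bd ac.
    + by move=> x /=; rewrite -(comm _ _ _ c0 b1) ca db.
apply: (gen_sub grp) fW => s sS.
have sW : Wint lam s by apply: sub_gen.
case: sS => gamma [/even_refl gr _ es]; rewrite -es in gr.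
by case: gr => gr; [exists s => //; exists id | exists id => //; exists s].
Qed.

(* Main.v *)
Require Import Defs.
From mathcomp Require Import all_boot all_order all_algebra all_fingroup all_solvable.
From mathcomp Require Import boolp classical_sets functions reals.
From mathcomp Require Import complex.
From mathcomp Require Import ring.

Set Implicit Arguments.
Unset Strict Implicit.
Unset Printing Implicit Defensive.

Local Open Scope classical_set_scope.

(** The factor W_lam^1 is generated by the reflections in those positive roots
of G_2 at which lam is integral ([Wint1E]): every generator of W_lam is either
s_0 or such a reflection, the two kinds commute, and <s_0> meets W_{G_2}
trivially.  So everything depends on which of the six numbers
<lam - rho, al^vee> are integers.

Write b and c for the eps-coordinates of lam - rho.  The six numbers are b, c,
c - b for the long roots and 2b - c, 2c - b, b + c for the short ones.  As soon
as b and c are integers all six are, and this happens for any two long roots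
and for any two non-orthogonal roots of different lengths; two of the short
numbers give the third.  What remains is the list of
[integral_roots_classified]: no root, one root, an orthogonal pair, the three
short roots, or all six.

In the four non-empty cases the group is generated by two reflections s, t with
s t of order n = 1, 2, 3, 6.  A group generated by two involutions other than
the identity is determined up to isomorphism by the order n of their product:
its elements are (s t)^i and (s t)^i s with i < n, all distinct, and the
multiplication rule depends on n only.  [dihedral_iso] turns this into
isomorphisms with Z_2, Z_2 x Z_2, S_3 and D_12, each of which has such a pair of
generators.  The five possible orders 1, 2, 4, 6, 12 being distinct, the
isomorphism type of W_lam^1 determines the case.

The two remaining claims compare W_lam with W_lam^1; the two agree unless lam is
2delta-integral ([Wint_Wint1]).  Atypicality says that (lam, delta) is, up to
sign, one of the numbers (lam, eps_i), so 2delta-integrality makes some short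
root integral ([atypical_integral]) and W_lam^1 non-trivial.  If W_lam^1 is all
of W_{G_2} then all six roots are integral, so the root at which lam fails to be
integral is 2delta. *)

(** * Groups generated by two involutions *)

Definition dihedral_pair (T : Type) (n : nat) (s t : T -> T) : Prop :=
  [/\ cancel s s, cancel t t, s <> id, t <> id &
      forall i, iter i (s \o t) = id <-> n %| i].

(** The two components of [k] are the exponents in the normal form
(s t)^i s^b. *)
Definition dih (T : Type) (s t : T -> T) (k : nat * bool) : T -> T :=
  iter k.1 (s \o t) \o (if k.2 then s else id).

(** The product of normal forms, from s (s t)^j = (s t)^(-j) s, where -j is
written as the natural number (n - 1) j. *)
Definition dih_mul (n : nat) (k l : nat * bool) : nat * bool :=
  ((if k.2 then k.1 + n.-1 * l.1 else k.1 + l.1)%N, k.2 (+) l.2).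

Section DihedralPair.

Variables (T : Type) (n : nat) (s t : T -> T).
Hypotheses (n_gt0 : 0 < n) (st_pair : dihedral_pair n s t).

Let ss : cancel s s. Proof. by case: st_pair. Qed.
Let tt : cancel t t. Proof. by case: st_pair. Qed.

Lemma iter_st_dvd i v : n %| i -> iter i (s \o t) v = v.
Proof. by case: st_pair => _ _ _ _ ord /ord ->. Qed.

(** Conjugation by s inverts s t; this form avoids inverses. *)
Lemma iter_st_conj i v : iter i (s \o t) (s (iter i (s \o t) v)) = s v.
Proof.
by elim: i v => [//|i IHi] v; rewrite iterS iterSr IHi /= ss tt.
Qed.

Lemma iter_st_commute i v :
  s (iter i (s \o t) v) = iter (n.-1 * i) (s \o t) (s v).
Proof.
rewrite -[in RHS](iter_st_conj i v) -iterD -mulSnr prednK //.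
by rewrite [in RHS]iter_st_dvd // dvdn_mulr.
Qed.

Lemma dih_comp k l : dih s t k \o dih s t l = dih s t (dih_mul n k l).
Proof.
case: k l => [i b] [j c]; apply: funext => v; rewrite /dih /dih_mul /=.
by case: b; case: c => /=; rewrite ?iter_st_commute ?ss iterD.
Qed.

(** If s were a power r^i of r = s t, it would commute with r, which it also
inverts; hence r^2 = id and r^i is id or r, according to the parity of i.  The
first makes s the identity, the second makes t the identity. *)
Lemma dih_id k : dih s t k = id -> n %| k.1 /\ k.2 = false.
Proof.
have [_ _ s1 t1 ord] := st_pair.
case: k => i [] /= kid; last by split=> //; apply/ord.
have rs v : iter i (s \o t) v = s v.
  by have := congr1 (@^~ (s v)) kid; rewrite /dih /= ss.
have r2 v : s (t (s (t v))) = v.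
  have := rs (s (t (t v))); rewrite -[s (t (t v))]/((s \o t) (t v)).
  by rewrite -iterSr iterS rs /= ss tt.
have r2m m v : iter m.*2 (s \o t) v = v.
  by elim: m v => [//|m IHm] v; rewrite doubleS 2!iterS IHm /= r2.
case: (boolP (odd i)) => oi; [case: t1 | case: s1]; apply: funext => v.
  have := rs v; rewrite -(odd_double_half i) oi iterD r2m /=.
  by move/(can_inj ss).
by rewrite -rs -(odd_double_half i) (negbTE oi) r2m.
Qed.

(** Cancelling (s t)^j on the left and s^c on the right reduces equality of two
normal forms to [dih_id]. *)
Lemma dih_eq k l : dih s t k = dih s t l <-> k.1 = l.1 %[mod n] /\ k.2 = l.2.
Proof.
have [_ _ _ _ ord] := st_pair.
case: k l => [i b] [j c]; split=> /= [e|[e ->]]; last first.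
  suff rE m : iter m (s \o t) = iter (m %% n) (s \o t) :> (T -> T).
    by rewrite /dih /= rE e -rE.
  apply: funext => v; rewrite [in LHS](divn_eq m n) addnC iterD.
  by rewrite (iter_st_dvd _ (dvdn_mull _ (dvdnn n))).
pose m := (n.-1 * j)%N; have mj : (m + j)%N = (n * j)%N.
  by rewrite /m -mulSnr prednK.
have [|/= dv bc] := @dih_id (dih_mul n (dih_mul n (m, false) (i, b)) (0, c)).
  rewrite -!dih_comp e !dih_comp /dih_mul /= addbb muln0 !addn0 if_same mj.
  by apply: funext => v; rewrite /dih /= iter_st_dvd // dvdn_mulr.
have {bc} -> : b = c by case: b c bc {e dv} => [] [].
split=> //; move: dv; rewrite muln0 !addn0 if_same => dv; apply/eqP.
by rewrite -(eqn_modDl m) mj modnMr (eqP dv).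
Qed.

Lemma gen_dih : gen [set s; t] = range (dih s t).
Proof.
have sE : dih s t (0, true) = s by [].
(* t = s (s t) = (s t)^(n - 1) s *)
have tE : dih s t (n.-1, true) = t.
  apply: funext => v; have := iter_st_commute 1 v.
  by rewrite muln1 /dih /= => <-; rewrite ss.
have idE m : n %| m -> dih s t (m, false) = id.
  by move=> dv; apply: funext => v; rewrite /dih /= iter_st_dvd.
apply/seteqP; split.
  apply: gen_sub; last first.
    by move=> _ [] ->; [exists (0, true) | exists (n.-1, true)].
  split=> [|_ _ [k _ <-] [l _ <-]|_ [[i b] _ <-]]; first by exists (0, false).
    by rewrite dih_comp; exists (dih_mul n k l).
  pose k := ((if b then i else n.-1 * i)%N, b).
  have [ik ki] : dih s t (i, b) \o dih s t k = id /\
                 dih s t k \o dih s t (i, b) = id.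
    rewrite !dih_comp /dih_mul /= addbb.
    by case: b @k => /=; rewrite !idE // ?[(i + _)%N]addnC;
      rewrite -mulSnr prednK // dvdn_mulr.
  exists (dih s t k); split; first by exists k.
    by move=> v; rewrite -[LHS]/((dih s t k \o dih s t (i, b)) v) ki.
  by move=> v; rewrite -[LHS]/((dih s t (i, b) \o dih s t k) v) ik.
have [|id_G mul_G _] := @gen_group _ [set s; t].
  by move=> _ [] ->.
have sG : gen [set s; t] s by apply: Defs.sub_gen; left.
have tG : gen [set s; t] t by apply: Defs.sub_gen; right.
move=> _ [[i b] _ <-]; apply: (mul_G); last by case: b.
elim: i => [//|i IHi]; rewrite -[iter _ _]/((s \o t) \o iter i (s \o t)).
by apply: (mul_G) => //; apply: mul_G.
Qed.

End DihedralPair.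

(** Left translations carry the normal form of functions over to finite
groups. *)
Lemma dihedral_pair_mulg (gT : finGroupType) (y z : gT) :
  #[y]%g = 2 -> #[z]%g = 2 -> dihedral_pair #[y * z]%g (mulg y) (mulg z).
Proof.
move=> oy oz.
have iterE (x : gT) i v : iter i (mulg x) v = (x ^+ i * v)%g.
  by elim: i => [|i IHi]; rewrite ?mul1g // iterS IHi expgS mulgA.
have rotE i : iter i (mulg y \o mulg z) = mulg ((y * z) ^+ i)%g.
  apply: funext => v; rewrite -iterE; apply: eq_iter => w /=; exact: mulgA.
have inv (x : gT) : #[x]%g = 2 -> cancel (mulg x) (mulg x).
  by move=> ox v; rewrite mulgA -expg2 -ox expg_order mul1g.
have ne1 (x : gT) : #[x]%g = 2 -> mulg x <> id.
  by move=> ox /(congr1 (@^~ 1%g)); rewrite mulg1 => x1;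
    rewrite x1 order1 in ox.
split; [exact: inv|exact: inv|exact: ne1|exact: ne1|move=> i].
rewrite rotE order_dvdn; split=> [/(congr1 (@^~ 1%g))|/eqP ->].
  by rewrite mulg1 => ->.
by apply: funext => v; rewrite mul1g.
Qed.

(** Equality and multiplication of normal forms depend on n alone, so matching
them is a well-defined injective morphism.  The 2n normal forms in H are
distinct, so they exhaust H by counting. *)
Theorem dihedral_iso (T : Type) (n : nat) (s t : T -> T)
    (gT : finGroupType) (H : {group gT}) (y z : gT) :
  0 < n -> dihedral_pair n s t -> y \in H -> z \in H ->
  #[y]%g = 2 -> #[z]%g = 2 -> #[y * z]%g = n -> #|H| = n.*2 ->
  group_iso (gen [set s; t]) H.
Proof.
move=> n0 st_pair yH zH oy oz oyz oH.
have yz_pair := dihedral_pair_mulg oy oz; rewrite oyz in yz_pair.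
(* The value at 1 recovers from a translation the element (y z)^i y^b of H. *)
pose h k := dih (mulg y) (mulg z) k 1%g.
have dihE k v : dih (mulg y) (mulg z) k v = (h k * v)%g.
  case: k => i b; rewrite /h /dih /=.
  elim: i => [|i IHi]; first by case: b => /=; rewrite ?mulg1 ?mul1g.
  by rewrite !iterS IHi /= -!mulgA.
have h_eq k l : h k = h l <-> dih s t k = dih s t l.
  rewrite (dih_eq n0 st_pair) -(dih_eq n0 yz_pair).
  split=> [e|e]; last by rewrite /h e.
  by apply: funext => v; rewrite !dihE e.
have h_mul k l : (h k * h l)%g = h (dih_mul n k l).
  by rewrite -dihE /h -(dih_comp n0 yz_pair).
have hH k : h k \in H.
  case: k => i b; rewrite /h /dih /=.
  elim: i => [|i IHi]; first by case: b => /=; rewrite ?mulg1.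
  by rewrite iterS /= !groupM.
(* Any normal form of w will do; the default is irrelevant on the group. *)
pose k w := xget (0, false) [set k | dih s t k = w].
have kP l : dih s t (k (dih s t l)) = dih s t l.
  exact: (@xgetI _ _ [set k | dih s t k = dih s t l] l).
have hk l : h (k (dih s t l)) = h l by apply/h_eq.
rewrite (gen_dih n0 st_pair); exists (h \o k); split; last first.
  move=> _ _ [l _ <-] [m _ <-] /=.
  by rewrite (dih_comp n0 st_pair) !hk h_mul.
split; first by move=> _ [l _ <-]; rewrite /= hk; exact: hH.
  by move=> _ _ /set_mem[l _ <-] /set_mem[m _ <-] /=; rewrite !hk => /h_eq.
pose hf (p : 'I_n * bool) := h (val p.1, p.2).
have hf_inj : injective hf.
  move=> [i b] [j c] /h_eq /(dih_eq n0 st_pair) /= [].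
  by rewrite !modn_small // => /val_inj -> ->.
have <- : hf @: [set: 'I_n * bool]%SET = H.
  apply/eqP; rewrite eqEcard oH card_imset // cardsT card_prod.
  rewrite card_ord card_bool muln2 leqnn andbT.
  by apply/fintype.subsetP => _ /imsetP[p _ ->]; exact: hH.
move=> _ /imsetP[p _ ->]; exists (dih s t (val p.1, p.2)) => /=; last exact: hk.
by exists (val p.1, p.2).
Qed.

Lemma iter_id_dvd (T : Type) (n : nat) (f : T -> T) :
  0 < n -> iter n f = id -> (forall i, 0 < i < n -> iter i f <> id) ->
  forall i, iter i f = id <-> n %| i.
Proof.
move=> n0 fn fi i; have iterE : iter i f = iter (i %% n) f.
  apply: funext => v; rewrite [in LHS](divn_eq i n) addnC iterD iterM.
  by rewrite fn; congr iter; elim: (i %/ n) => //= m ->.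
rewrite iterE; split=> [e|/eqP -> //]; apply: contrapT => /negP ni.
by apply: (fi (i %% n)) => //; rewrite lt0n ni ltn_mod.
Qed.

(** Two isomorphisms from G match H with H'; as G is a set of functions on an
arbitrary type, the inverse of each one is obtained by choice. *)
Lemma group_iso_card (T : Type) (G : set (T -> T))
    (gT gT' : finGroupType) (H : {set gT}) (H' : {set gT'}) :
  group_iso G H -> group_iso G H' -> #|H| = #|H'|.
Proof.
move=> [f [[fG finj fsurj] _]] [g [[gG ginj gsurj] _]].
have le (aT bT : finType) (A : {set aT}) (B : {set bT}) (u : (T -> T) -> aT)
    (v : (T -> T) -> bT) :
    set_surj G [set` A] u -> set_fun G [set` B] v -> set_inj G v ->
    #|A| <= #|B|.
  move=> usurj vB vinj.
  have [w wP] : {w : aT -> T -> T &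
      forall a, a \in A -> G (w a) /\ u (w a) = a}.
    apply: (boolp.choice (P := fun a x => a \in A -> G x /\ u x = a)) => a.
    by case: (boolP (a \in A)) => [/usurj[x Gx xa]|_]; [exists x | exists id].
  rewrite -(@card_in_imset _ _ (v \o w) (mem A)); last first.
    move=> a b /wP[Ga ea] /wP[Gb eb] /= /vinj eab.
    by rewrite -ea -eb eab // inE.
  apply/subset_leq_card/fintype.subsetP => _ /imsetP[a /wP[Ga _] ->].
  exact: vB.
by apply/eqP; rewrite eqn_leq (le _ _ _ _ f g) // (le _ _ _ _ g f).
Qed.

(** * The finite groups of the list *)

Section Models.

Variables (T : Type) (s t : T -> T).

(** The case s = t, in which both involutions go to the generator. *)
Lemma dihedral_iso_Z2 :
  dihedral_pair 1 s t -> group_iso (gen [set s; t]) [set: 'Z_2]%SET.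
Proof.
move=> st.
have o1 : #[1%R : 'Z_2]%g = 2.
  by apply: nt_prime_order => //; apply: val_inj.
apply: (dihedral_iso (y := 1%R : 'Z_2) (z := 1%R : 'Z_2) _ st);
  rewrite ?inE ?cardsT ?card_ord //.
by apply/eqP; rewrite order_eq1.
Qed.

Lemma dihedral_iso_Z2xZ2 :
  dihedral_pair 2 s t -> group_iso (gen [set s; t]) [set: 'Z_2 * 'Z_2]%SET.
Proof.
move=> st.
apply: (dihedral_iso (y := (1%R, 1%g) : 'Z_2 * 'Z_2)
                     (z := (1%g, 1%R) : 'Z_2 * 'Z_2) _ st);
  rewrite ?inE ?cardsT ?card_prod ?card_ord //; apply: nt_prime_order => //;
  by congr pair; apply: val_inj.
Qed.

Lemma dihedral_iso_S3 :
  dihedral_pair 3 s t -> group_iso (gen [set s; t]) [set: 'S_3]%SET.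
Proof.
move=> st.
apply: (dihedral_iso (y := tperm 0%R 1%R : 'S_3)
                     (z := tperm 1%R 2%R : 'S_3) _ st);
  rewrite ?inE ?cardsT ?card_Sn //; apply: nt_prime_order => //.
- by rewrite expgS expg1 tperm2.
- by apply/eqP => /permP /(_ 0%R); rewrite tpermL perm1.
- by rewrite expgS expg1 tperm2.
- by apply/eqP => /permP /(_ 1%R); rewrite tpermL perm1.
- apply/permP => -[[|[|[|//]]] ?]; rewrite !expgS expg0 !permM !permE /=;
  exact: val_inj.
- by apply/eqP => /permP /(_ 0%R); rewrite permM tpermL tpermL perm1.
Qed.

(** The presentation of the dihedral group supplies y and z with
y^2 = z^2 = (y z)^n = 1.  These orders are exact: if y or z were trivial, or if
they were equal, the group would have at most two elements; and if y z had order
m, the group would be a quotient of the dihedral group of order 2m. *)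
Lemma dihedral_iso_D n :
  1 < n -> dihedral_pair n s t -> group_iso (gen [set s; t]) [set: 'D_n.*2]%SET.
Proof.
move=> n1 st; have oD := card_dihedral n1.
have /existsP[[y z] /=] : ([set: 'D_n.*2]%SET \homg
    Grp (y : z : y ^+ 2, z ^+ 2, (y * z) ^+ n))%g.
  by rewrite -Grp'_dihedral // homg_refl.
rewrite !xpair_eqE => /and4P[/eqP Dyz /eqP y2 /eqP z2 /eqP yzn].
have not_cyc (v : 'D_n.*2) : (v ^+ 2 = 1 -> <[v]> <> [set: 'D_n.*2]%SET)%g.
  move=> v2 Dv; have : #|[set: 'D_n.*2]%SET| <= 2.
    by rewrite -Dv -orderE dvdn_leq // order_dvdn v2.
  by rewrite oD leqNgt -[2]/(1.*2) ltn_double n1.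
have oy : #[y]%g = 2.
  apply: nt_prime_order => //; apply/eqP => y1; apply: (not_cyc z) => //.
  by rewrite -Dyz y1 cycle1 joing1G.
have oz : #[z]%g = 2.
  apply: nt_prime_order => //; apply/eqP => z1; apply: (not_cyc y) => //.
  by rewrite -Dyz z1 cycle1 joingG1.
apply: (dihedral_iso (y := y) (z := z) _ st); rewrite ?inE ?(ltnW n1) //.
apply/eqP; rewrite eqn_dvd order_dvdn yzn eqxx /=.
have yz1 : 1 < #[y * z]%g.
  rewrite order_gt1; apply/eqP => /eqP; rewrite -eq_invg_mul => /eqP yz.
  apply: (not_cyc y) => //.
  by rewrite -Dyz -yz cycleV joingE finset.setUid genGid.
have : ([set: 'D_n.*2]%SET \homg [set: 'D_#[y * z].*2]%SET)%g.
  rewrite Grp'_dihedral //; apply/existsP; exists (y, z).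
  by rewrite /= !xpair_eqE Dyz y2 z2 expg_order !eqxx.
have dvd2 m : n.*2 %| m.*2 -> n %| m by rewrite -!mul2n dvdn_pmul2l.
move/card_homg => dvdD; apply: dvd2.
by rewrite -(card_dihedral yz1) -[X in X %| _]oD.
Qed.

End Models.

Lemma trivial_iso (T : Type) : group_iso [set id : T -> T] [1 'Z_2]%g.
Proof.
exists (fun=> 1%g); split=> [|f g _ _]; last by rewrite mulg1.
split; first by move=> f _ /=; apply: set11.
  by move=> f g /set_mem -> /set_mem ->.
by move=> x /set1P ->; exists id.
Qed.

Local Open Scope ring_scope.
Import GRing.Theory Num.Theory.

(** * Reflections in the roots of G_2 *)

(** Each pair consists of a short root and the long root orthogonal to it. *)
Definition orth_pairs (R : realType) : seq (hstar R * hstar R) :=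
  [:: (- eps3, eps2 - eps1); (eps1, eps2 - eps3); (eps2, eps1 - eps3)].

Section G2.

Variable R : realType.
Implicit Types (lam v al be : hstar R) (x y : R[i]%C) (b c : int).

(** On vectors with integer coordinates, inequality of two images is decided by
computation. *)
Definition int_row b c : hstar R := coord_row 0 b%:~R c%:~R.

Lemma int_row_inj b c b' c' : int_row b c = int_row b' c' -> (b, c) = (b', c').
Proof.
move=> e; have := congr1 (fun v : hstar R => v 0 1) e.
have := congr1 (fun v : hstar R => v 0 2) e.
by rewrite !coord_rowE => /intr_inj -> /intr_inj ->.
Qed.

Lemma refl_int_row b c :
  ((refl eps1 (int_row b c) = int_row (c - b) c) *
   (refl eps2 (int_row b c) = int_row b (b - c)) *
   (refl (- eps3) (int_row b c) = int_row (- c) (- b)) *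
   (refl (eps2 - eps1) (int_row b c) = int_row c b) *
   (refl (eps1 - eps3) (int_row b c) = int_row (- b) (c - b)) *
   (refl (eps2 - eps3) (int_row b c) = int_row (b - c) (- c)))%type.
Proof. by rewrite /int_row !even_reflE !rmorphB !rmorphN. Qed.

(** An identity between products of reflections, checked coordinatewise. *)
Local Ltac coords := apply: funext; let v := fresh in intro v;
  rewrite /= [v]hstarE !even_reflE; congr coord_row; ring.

(** The vector eps1 + 3 eps2 is orthogonal to no root of G_2, so its stabilizer
in the Weyl group is trivial and a product of reflections that is not the
identity moves it. *)
Local Ltac moved := let e := fresh in
  move=> /(congr1 (@^~ (int_row 1 3))) e; move: e;
  rewrite /= !refl_int_row => /int_row_inj.

Lemma refl_neq_id al : al \in pos_even_circ R -> refl al <> id.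
Proof.
by rewrite !inE; do 5![case/predU1P => [->|]; first by moved];
  move/eqP=> ->; moved.
Qed.

Lemma circ_even al : al \in pos_even_circ R -> al \in even_roots R.
Proof. by move=> alP; rewrite mem_cat /pos_even in_cons alP orbT. Qed.

Lemma root_pair n al be :
  al \in pos_even_circ R -> be \in pos_even_circ R -> (0 < n)%N ->
  iter n (refl al \o refl be) = id ->
  (forall i, (0 < i < n)%N -> iter i (refl al \o refl be) <> id) ->
  dihedral_pair n (refl al) (refl be).
Proof.
move=> alP beP n0 rn ri.
split; try exact: refl_neq_id; try exact/refl2/circ_even.
exact: iter_id_dvd.
Qed.

Lemma root_pair1 al : al \in pos_even_circ R ->
  dihedral_pair 1 (refl al) (refl al).
Proof.
move=> alP; apply: root_pair => //; last by case=> [|[]].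
by apply: funext => v; apply/refl2/circ_even.
Qed.

Lemma root_pair2 p : p \in orth_pairs R ->
  dihedral_pair 2 (refl p.1) (refl p.2).
Proof.
rewrite !inE => /or3P[] /eqP -> /=.
all: apply: root_pair => //; try by rewrite !inE eqxx ?orbT.
all: try by coords.
all: by case=> [|[|[]]] // _; moved.
Qed.

Lemma root_pair3 : dihedral_pair 3 (@refl R eps1) (refl eps2).
Proof.
apply: root_pair => //; try by rewrite !inE eqxx ?orbT.
  by coords.
by case=> [|[|[|[]]]] // _; moved.
Qed.

Lemma root_pair6 : dihedral_pair 6 (@refl R (eps2 - eps1)) (refl eps1).
Proof.
apply: root_pair => //; try by rewrite !inE eqxx ?orbT.
  by coords.
by case=> [|[|[|[|[|[|[]]]]]]] // _; moved.
Qed.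

Lemma circ_WG2 al : al \in pos_even_circ R -> WG2 R (refl al).
Proof.
have [_ WM _] := WG2_group R.
have W1 : WG2 R (refl (eps2 - eps1)) by apply: Defs.sub_gen; left.
have W2 : WG2 R (refl eps1) by apply: Defs.sub_gen; right.
by rewrite !inE; do 5![case/predU1P => [->|];
    first by rewrite ?refl_words; repeat apply: (WM)];
  move=> /eqP ->; rewrite !refl_words; repeat apply: (WM).
Qed.

(** * The integral Weyl group as a reflection group *)

Definition weyl (l : seq (hstar R)) : set (hstar R -> hstar R) :=
  gen (@refl R @` [set` l]).

Lemma weyl_group l : {subset l <= even_roots R} -> is_group (weyl l).
Proof. by move=> le; apply: gen_group => _ [al /le alP <-]; apply: refl2. Qed.

Lemma weyl_nil : weyl [::] = [set id].
Proof.
apply/seteqP; split.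
  apply: gen_sub; last by move=> s [].
  split=> // [_ _ -> -> //|_ ->]; by exists id.
by move=> _ ->; have [] := @weyl_group [::] _.
Qed.

Lemma weyl_seq1 al : weyl [:: al] = gen [set refl al].
Proof.
congr gen; apply/seteqP; split=> s.
  by move=> [be /=]; rewrite inE => /eqP -> <-.
by move=> /= ->; exists al => //=; rewrite inE.
Qed.

Lemma weyl_seq2 al be : weyl [:: al; be] = gen [set refl al; refl be].
Proof.
congr gen; apply/seteqP; split=> s.
  by move=> [ga /=]; rewrite !inE => /orP[] /eqP -> <-; [left | right].
by move=> [] ->; [exists al | exists be] => //=; rewrite !inE eqxx ?orbT.
Qed.

Lemma weyl_circ : weyl (pos_even_circ R) = WG2 R.
Proof.
apply/seteqP; split.
  apply: gen_sub; first exact: WG2_group.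
  by move=> _ [al alP <-]; apply: circ_WG2.
apply: gen_sub; first exact/weyl_group/circ_even.
by move=> _ [] ->; apply: Defs.sub_gen;
  [exists (eps2 - eps1) | exists eps1] => //=; rewrite !inE eqxx ?orbT.
Qed.

Lemma weyl_short3 :
  weyl [:: eps1; eps2; - eps3] = gen [set refl eps1; refl eps2; refl (- eps3)].
Proof.
congr gen; apply/seteqP; split=> s.
  move=> [ga /=]; rewrite !inE => /or3P[] /eqP -> <-.
  - by left; left.
  - by left; right.
  - by right.
by move=> [[]|] ->; [exists eps1 | exists eps2 | exists (- eps3)] => //=;
  rewrite !inE eqxx ?orbT.
Qed.

(** The third reflection is the conjugate s_{eps1} s_{eps2} s_{eps1}. *)
Lemma gen_short3 :
  gen [set refl eps1; refl eps2; refl (- eps3)] =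
  gen [set @refl R eps1; refl eps2].
Proof.
have inv al : al \in pos_even_circ R -> cancel (refl al) (refl al).
  by move=> /circ_even /refl2.
apply/seteqP; split; apply: gen_sub.
- by apply: gen_group => _ [] ->; apply: inv; rewrite !inE eqxx ?orbT.
- have [|_ GM _] := @gen_group _ [set @refl R eps1; refl eps2].
    by move=> _ [] ->; apply: inv; rewrite !inE eqxx ?orbT.
  have G1 : gen [set @refl R eps1; refl eps2] (refl eps1).
    by apply: Defs.sub_gen; left.
  have G2 : gen [set @refl R eps1; refl eps2] (refl eps2).
    by apply: Defs.sub_gen; right.
  move=> _ [[] ->|->]; [exact: G1|exact: G2|].
  by rewrite (refl_words R).1.1.2; exact: (GM _ _ (GM _ _ G1 G2) G1).
- by apply: gen_group => _ [[]|] ->; apply: inv; rewrite !inE eqxx ?orbT.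
- by move=> s sS; apply: Defs.sub_gen; left.
Qed.

Definition integral_roots lam : seq (hstar R) :=
  [seq al <- pos_even_circ R | `[< integral_at al lam >]].

Lemma integral_rootsP lam al :
  al \in integral_roots lam <-> al \in pos_even_circ R /\ integral_at al lam.
Proof.
rewrite mem_filter; split=> [/andP[/asboolP] //|[alP /asboolP ->]].
by rewrite alP.
Qed.

Lemma integral_atN al lam : integral_at (- al) lam -> integral_at al lam.
Proof.
have copairN v : copair v al = - copair v (- al).
  by rewrite /copair /Defs.form !mxE -mulNr; congr (_ / _); ring.
by move=> [m e]; exists (- m); rewrite copairN e rmorphN.
Qed.

(** The reflections in a root and in its opposite coincide, so positive roots
give all the generators. *)
Lemma Wint_gens lam s :
  (exists ga, [/\ ga \in even_roots R, integral_at ga lam & s = refl ga]) ->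
  (integral_at (2 *: delta) lam /\ s = refl (2 *: delta)) \/
  exists2 al, al \in integral_roots lam & s = refl al.
Proof.
have pos ga : ga \in pos_even R -> integral_at ga lam ->
    (integral_at (2 *: delta) lam /\ refl ga = refl (2 *: delta)) \/
    exists2 al, al \in integral_roots lam & refl ga = refl al.
  rewrite inE => /predU1P[-> lamI|gaP lamI]; first by left.
  by right; exists ga => //; apply/integral_rootsP.
move=> [ga [+ lamI ->]]; rewrite mem_cat => /orP[gaP|/mapP[be beP ga_be]].
  exact: pos.
rewrite ga_be reflN; apply: pos => //; apply: integral_atN.
by rewrite -ga_be.
Qed.

Lemma integral_roots_circ lam :
  {subset integral_roots lam <= pos_even_circ R}.
Proof. by move=> al /integral_rootsP[]. Qed.

Lemma weyl_sub_Wint1 lam : weyl (integral_roots lam) `<=` Wint1 lam.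
Proof.
have sub al : al \in integral_roots lam ->
    Wint lam (refl al) /\ WG2 R (refl al).
  move=> /integral_rootsP[alP lamI]; split; last exact: circ_WG2.
  by apply: Defs.sub_gen; exists al; split=> //; apply: circ_even.
move=> w ww; split; apply: gen_sub ww.
- exact: Wint_group.
- by move=> _ [al /sub[] ? _ <-].
- exact: WG2_group.
- by move=> _ [al /sub[] _ ? <-].
Qed.

(** The inverse of a product of commuting elements is the product of the
inverses. *)
Lemma prod_group (T : Type) (A B : set (T -> T)) :
  is_group A -> is_group B ->
  (forall a b : T -> T, A a -> B b -> a \o b = b \o a) ->
  is_group [set a \o b | a in A & b in B].
Proof.
move=> [A1 AM AV] [B1 BM BV] AB.
have comm (a b : T -> T) (x : T) : A a -> B b -> a (b x) = b (a x).
  by move=> Aa Bb; rewrite -[LHS]/((a \o b) x) AB.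
split.
- by exists id => //; exists id.
- move=> _ _ [a Aa [b Bb <-]] [a' Aa' [b' Bb' <-]].
  exists (a \o a'); first exact: AM.
  exists (b \o b'); first exact: BM.
  by apply: funext => x /=; rewrite (comm a' b).
- move=> _ [a Aa [b Bb <-]].
  have [c [Ac ac ca]] := AV _ Aa; have [d [Bd bd db]] := BV _ Bb.
  exists (c \o d); split.
  + by exists c => //; exists d.
  + by move=> x /=; rewrite (comm a b) // bd ac.
  + by move=> x /=; rewrite (comm c d) // db ca.
Qed.

(** The products a b, with a in <s_0> and b generated by the integral
reflections of G_2, form a group containing the generators of W_lam.  If such a product lies
in W_{G_2}, then so does a, and a = id. *)
Lemma Wint1E lam : Wint1 lam = weyl (integral_roots lam).
Proof.
apply/seteqP; split; last exact: weyl_sub_Wint1.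
have wgrp : is_group (weyl (integral_roots lam)).
  by apply: weyl_group => al /integral_roots_circ /circ_even.
have wW : weyl (integral_roots lam) `<=` WG2 R by move=> w /weyl_sub_Wint1[].
move=> w [ww wG2].
have [a Wa [b wb ab]] :
    [set a \o b | a in W0 R & b in weyl (integral_roots lam)] w.
  apply: gen_sub ww.
    apply: prod_group => //; first exact: W0_group.
    by move=> a b Wa /wW; apply: W0_WG2_comm.
  move=> s /Wint_gens[[_ ->]|[al alI ->]].
    exists (refl (2 *: delta)); first exact: Defs.sub_gen.
    by exists id => //; case: wgrp.
  exists id; first by case: (W0_group R).
  by exists (refl al) => //; apply: Defs.sub_gen; exists al.
have [_ WM WV] := WG2_group R; have [c [Wc bc cb]] := WV _ (wW _ wb).
suff ea : a = id by rewrite -ab ea.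
suff : (W0 R `&` WG2 R) a by rewrite W0_WG2_triv.
split=> //; suff -> : a = w \o c by exact: WM.
by rewrite -ab; apply: funext => x /=; rewrite cb.
Qed.

Lemma Wint_Wint1 lam : ~ integral_at (2 *: delta) lam -> Wint lam = Wint1 lam.
Proof.
move=> nI; apply/seteqP; split=> [|w []//]; rewrite Wint1E.
apply: gen_sub.
  by apply: weyl_group => al /integral_roots_circ /circ_even.
move=> s /Wint_gens[[]//|[al alI ->]].
by apply: Defs.sub_gen; exists al.
Qed.

(** * Atypicality and integral roots *)

Lemma rho_coord (j : 'I_3) :
  rho R 0 j = coord_row (- (5 / 2)) 2 3 0 j.
Proof. by []. Qed.

Lemma copair_sub_rho lam :
  ((copair (lam - rho R) (2 *: delta) = lam 0 0 + 5 / 2) *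
   (copair (lam - rho R) eps1 = 2 * lam 0 1 - lam 0 2 - 1) *
   (copair (lam - rho R) eps2 = 2 * lam 0 2 - lam 0 1 - 4) *
   (copair (lam - rho R) (- eps3) = lam 0 1 + lam 0 2 - 5)).
Proof.
have E j : (lam - rho R) 0 j = lam 0 j - rho R 0 j by rewrite !mxE.
by rewrite !copair_even !E !rho_coord !coord_rowE; do !split; ring.
Qed.

(** When lam is 2delta-integral its delta-coordinate is a half-integer, so that
(lam, delta) is an integer.  If lam is orthogonal to delta + eps_i or
delta - eps_i, then (lam, eps_i) is an integer, and
<lam, eps_i^vee> = (lam, eps_i) since (eps_i, eps_i) = 2. *)
Lemma atypical_integral lam : atypical lam -> integral_at (2 *: delta) lam ->
  exists al, al \in integral_roots lam.
Proof.
move=> [be [beP be0]] [m]; rewrite copair_sub_rho => am.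
have root al (k : int) : al \in pos_even_circ R ->
    copair (lam - rho R) al = k%:~R -> exists al, al \in integral_roots lam.
  by move=> alP kE; exists al; apply/integral_rootsP; split=> //; exists k.
move: beP; rewrite !inE.
move=> /predU1P[|/predU1P[|/predU1P[|/predU1P[|/predU1P[|/eqP]]]]] be_;
  move: be0; rewrite be_ /Defs.form !mxE /= => be0.
(* With <lam - rho, (2delta)^vee> = m one has (lam, delta) = 5 - 2m.  So
   <lam, eps_i^vee> is 2m - 5 or 5 - 2m, and subtracting <rho, eps_i^vee>, which
   is 1, 4, -5 for i = 1, 2, 3, gives the integers below, up to the sign of
   - eps3. *)
all: [> apply: (root eps1 (2 * m - 6)) | apply: (root eps1 (4 - 2 * m))
  | apply: (root eps2 (2 * m - 9)) | apply: (root eps2 (1 - 2 * m))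
  | apply: (root (- eps3) (- (2 * m))) | apply: (root (- eps3) (2 * m - 10))].
all: rewrite ?inE ?eqxx ?orbT // copair_sub_rho.
all: rewrite ?rmorphB ?rmorphN rmorphM /= -am.
all: first [by rewrite -[RHS]addr0 -be0; field
           | by rewrite -[RHS]subr0 -be0; field].
Qed.

Definition is_int (x : R[i]%C) : Prop := exists m : int, x = m%:~R.

Lemma is_intB x y : is_int x -> is_int y -> is_int (x - y).
Proof. by move=> [m ->] [n ->]; exists (m - n); rewrite rmorphB. Qed.

Lemma is_intD x y : is_int x -> is_int y -> is_int (x + y).
Proof. by move=> [m ->] [n ->]; exists (m + n); rewrite rmorphD. Qed.

Definition classified l : Prop :=
  l = [::] \/ (exists2 al, al \in pos_even_circ R & l = [:: al]) \/
  (exists2 p, p \in orth_pairs R & l = [:: p.1; p.2]) \/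
  l = [:: eps1; eps2; - eps3] \/ l = pos_even_circ R.

(** Long roots are paired with c - b, b, c and short roots with 2b - c, 2c - b,
b + c, where b and c are the eps-coordinates of lam - rho; the integral
combinations of these numbers leave only twelve sets of roots. *)
Lemma integral_roots_classified lam : classified (integral_roots lam).
Proof.
rewrite /integral_roots /=; set v := lam - rho R.
(* The letter b stands for short roots and a for long ones; the orthogonal pairs
   are (b1, a3), (b2, a2) and (b3, a1). *)
set b1 := `[< integral_at eps1 lam >]; set b2 := `[< integral_at eps2 lam >].
set b3 := `[< integral_at (- eps3) lam >].
set a1 := `[< integral_at (eps2 - eps1) lam >].
set a2 := `[< integral_at (eps1 - eps3) lam >].
set a3 := `[< integral_at (eps2 - eps3) lam >].
have b1P : reflect (is_int (2 * v 0 1 - v 0 2)) b1.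
  by rewrite -(copair_even v).1.1.1.1.1.2; apply: asboolP.
have b2P : reflect (is_int (2 * v 0 2 - v 0 1)) b2.
  by rewrite -(copair_even v).1.1.1.1.2; apply: asboolP.
have b3P : reflect (is_int (v 0 1 + v 0 2)) b3.
  by rewrite -(copair_even v).1.1.1.2; apply: asboolP.
have a1P : reflect (is_int (v 0 2 - v 0 1)) a1.
  by rewrite -(copair_even v).1.1.2; apply: asboolP.
have a2P : reflect (is_int (v 0 1)) a2.
  by rewrite -(copair_even v).1.2; apply: asboolP.
have a3P : reflect (is_int (v 0 2)) a3.
  by rewrite -(copair_even v).2; apply: asboolP.
(* All the implications except the last three pass through the integrality of
   the two coordinates, which are the numbers of a2 and a3. *)
have clos : [&& (a1 && a2 ==> a3), (a1 && a3 ==> a2), (a1 && b1 ==> a2 && a3),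
    (a1 && b2 ==> a2 && a3), (a2 && b1 ==> a3), (a2 && b3 ==> a3),
    (a3 && b2 ==> a2), (a3 && b3 ==> a2), (a2 && a3 ==> [&& a1, b1, b2 & b3]),
    (b1 && b2 ==> b3), (b1 && b3 ==> b2) & (b2 && b3 ==> b1)].
  set x := v 0 1 in a1P a2P a3P b1P b2P b3P.
  set y := v 0 2 in a1P a2P a3P b1P b2P b3P.
  have D z u w : w = z + u -> is_int z -> is_int u -> is_int w.
    by move=> ->; exact: is_intD.
  have B z u w : w = z - u -> is_int z -> is_int u -> is_int w.
    by move=> ->; exact: is_intB.
  apply/and5P; split.
  - apply/implyP => /andP[/a1P p /a2P q]; apply/a3P.
    by apply: (D _ _ _ _ p q); ring.
  - apply/implyP => /andP[/a1P p /a3P q]; apply/a2P.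
    by apply: (B _ _ _ _ q p); ring.
  - apply/implyP => /andP[/a1P p /b1P q].
    have xI : is_int x by apply: (D _ _ _ _ p q); ring.
    apply/andP; split; first exact/a2P.
    by apply/a3P; apply: (D _ _ _ _ p xI); ring.
  - apply/implyP => /andP[/a1P p /b2P q].
    have yI : is_int y by apply: (B _ _ _ _ q p); ring.
    apply/andP; split; last exact/a3P.
    by apply/a2P; apply: (B _ _ _ _ yI p); ring.
  apply/and5P; split.
  - apply/implyP => /andP[/a2P p /b1P q]; apply/a3P.
    by apply: (B _ _ _ _ (is_intD p p) q); ring.
  - apply/implyP => /andP[/a2P p /b3P q]; apply/a3P.
    by apply: (B _ _ _ _ q p); ring.
  - apply/implyP => /andP[/a3P p /b2P q]; apply/a2P.
    by apply: (B _ _ _ _ (is_intD p p) q); ring.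
  - apply/implyP => /andP[/a3P p /b3P q]; apply/a2P.
    by apply: (B _ _ _ _ q p); ring.
  apply/and4P; split.
  - apply/implyP => /andP[/a2P p /a3P q]; apply/and4P; split.
    + by apply/a1P; apply: is_intB.
    + by apply/b1P; apply: (B _ _ _ _ (is_intD p p) q); ring.
    + by apply/b2P; apply: (B _ _ _ _ (is_intD q q) p); ring.
    + by apply/b3P; apply: is_intD.
  - apply/implyP => /andP[/b1P p /b2P q]; apply/b3P.
    by apply: (D _ _ _ _ p q); ring.
  - apply/implyP => /andP[/b1P p /b3P q]; apply/b2P.
    by apply: (B _ _ _ _ q p); ring.
  - apply/implyP => /andP[/b2P p /b3P q]; apply/b1P.
    by apply: (B _ _ _ _ q p); ring.
have c1 al : al \in pos_even_circ R -> classified [:: al].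
  by move=> alP; right; left; exists al.
have c2 al be : (al, be) \in orth_pairs R -> classified [:: al; be].
  by move=> p; right; right; left; exists (al, be).
have c0 : classified [::] by left.
have c3 : classified [:: eps1; eps2; - eps3] by do 3!right; left.
have c4 : classified (pos_even_circ R) by do 4!right.
move: a1 a2 a3 b1 b2 b3 clos {a1P a2P a3P b1P b2P b3P}.
move=> [] [] [] [] [] [] //= _.
all: first [exact: c0 | apply: c1 | apply: c2 | exact: c3 | exact: c4].
all: by rewrite !inE eqxx ?orbT.
Qed.

Lemma Wint1_classified lam : let W := Wint1 lam in
  [\/ W = [set id],
      exists2 al, al \in pos_even_circ R & W = gen [set refl al],
      exists2 p, p \in orth_pairs R & W = gen [set refl p.1; refl p.2] |
      W = gen [set refl eps1; refl eps2; refl (- eps3)] \/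
      W = WG2 R /\ (forall al, al \in pos_even_circ R -> integral_at al lam)].
Proof.
rewrite /= Wint1E; have := integral_roots_classified lam.
case=> [->|[[al alP ->]|[[p pP ->]|[->|e]]]].
- by apply: Or41; apply: weyl_nil.
- by apply: Or42; exists al => //; rewrite weyl_seq1.
- by apply: Or43; exists p => //; rewrite weyl_seq2.
- by apply: Or44; left; apply: weyl_short3.
- apply: Or44; right; rewrite e weyl_circ; split=> // al.
  by rewrite -e => /integral_rootsP[].
Qed.

(** * Identification of the groups *)

Lemma gen1_iso (al : hstar R) : al \in pos_even_circ R ->
  group_iso (gen [set refl al]) [set: 'Z_2]%SET.
Proof.
by move=> alP; rewrite -[[set _]]setUid; apply/dihedral_iso_Z2/root_pair1.
Qed.

Lemma gen2_iso p : p \in orth_pairs R ->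
  group_iso (gen [set refl p.1; refl p.2]) [set: 'Z_2 * 'Z_2]%SET.
Proof. by move=> pP; apply/dihedral_iso_Z2xZ2/root_pair2. Qed.

Lemma gen3_iso : group_iso
  (gen [set refl eps1; refl eps2; @refl R (- eps3)]) [set: 'S_3]%SET.
Proof. by rewrite gen_short3; apply/dihedral_iso_S3/root_pair3. Qed.

Lemma WG2_iso : group_iso (WG2 R) [set: 'D_12]%SET.
Proof. by apply: (@dihedral_iso_D _ _ _ 6) => //; apply: root_pair6. Qed.

Lemma Wint1_neq_id (lam : hstar R) al :
  al \in integral_roots lam -> Wint1 lam <> [set id].
Proof.
move=> alI W1; have : Wint1 lam (refl al).
  by apply: weyl_sub_Wint1; apply: Defs.sub_gen; exists al.
rewrite W1; apply: refl_neq_id; exact: (integral_roots_circ alI).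
Qed.

Lemma gen1P (W : set (hstar R -> hstar R)) :
  (exists2 al, al \in pos_even_circ R & W = gen [set refl al]) <->
  W = gen [set refl (eps2 - eps1)] \/ W = gen [set refl eps1] \/
  W = gen [set refl (eps1 - eps3)] \/ W = gen [set refl (- eps3)] \/
  W = gen [set refl (eps2 - eps3)] \/ W = gen [set refl eps2].
Proof.
split=> [[al]|].
  rewrite !inE.
  move=> /predU1P[|/predU1P[|/predU1P[|/predU1P[|/predU1P[|/eqP]]]]] ->.
  - by right; left.
  - by do 5!right.
  - by do 3!right; left.
  - by left.
  - by do 2!right; left.
  - by do 4!right; left.
by case=> [|[|[|[|[|]]]]] ->; eexists; try reflexivity; rewrite !inE eqxx ?orbT.
Qed.

Lemma gen2P (W : set (hstar R -> hstar R)) :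
  (exists2 p, p \in orth_pairs R & W = gen [set refl p.1; refl p.2]) <->
  W = gen [set refl (- eps3); refl (eps2 - eps1)] \/
  W = gen [set refl eps1; refl (eps2 - eps3)] \/
  W = gen [set refl eps2; refl (eps1 - eps3)].
Proof.
split=> [[p]|].
  by rewrite !inE => /or3P[] /eqP ->; [left|right; left|right; right].
by case=> [|[|]] ->; [exists (- eps3, eps2 - eps1) | exists (eps1, eps2 - eps3)
  | exists (eps2, eps1 - eps3)] => //; rewrite !inE eqxx ?orbT.
Qed.

End G2.

Theorem theorem3p6 (R : realType) (lam : 'rV[R[i]%C]_3)
    (hatyp : atypical lam) (hnonint : nonintegral lam) :
  (group_iso (Wint1 lam) [1 'Z_2]%g \/
   group_iso (Wint1 lam) [set: 'Z_2]%SET \/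
   group_iso (Wint1 lam) [set: 'Z_2 * 'Z_2]%SET \/
   group_iso (Wint1 lam) [set: 'S_3]%SET \/
   group_iso (Wint1 lam) [set: 'D_12]%SET) /\
  (Wint1 lam = [set id] <-> Wint lam = [set id]) /\
  (group_iso (Wint1 lam) [set: 'Z_2]%SET <->
     Wint1 lam = gen [set refl (eps2 - eps1)] \/
     Wint1 lam = gen [set refl eps1] \/
     Wint1 lam = gen [set refl (eps1 - eps3)] \/
     Wint1 lam = gen [set refl (- eps3)] \/
     Wint1 lam = gen [set refl (eps2 - eps3)] \/
     Wint1 lam = gen [set refl eps2]) /\
  (group_iso (Wint1 lam) [set: 'Z_2 * 'Z_2]%SET <->
     Wint1 lam = gen [set refl (- eps3); refl (eps2 - eps1)] \/
     Wint1 lam = gen [set refl eps1; refl (eps2 - eps3)] \/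
     Wint1 lam = gen [set refl eps2; refl (eps1 - eps3)]) /\
  (group_iso (Wint1 lam) [set: 'S_3]%SET <->
     Wint1 lam = gen [set refl eps1; refl eps2; refl (- eps3)]) /\
  (Wint1 lam = WG2 R /\ group_iso (WG2 R) [set: 'D_12]%SET <->
     Wint lam = WG2 R).
Proof.
set W1 := Wint1 lam.
(* The order of W1, read off from any finite group isomorphic to it. *)
pose ord k := forall (gT : finGroupType) (H : {set gT}),
  group_iso W1 H -> #|H| = k.
have ordI k (gT : finGroupType) (H : {set gT}) :
    group_iso W1 H -> #|H| = k -> ord k.
  by move=> isoH <- gT' H' isoH'; apply: group_iso_card isoH' isoH.
have o1 : #|[1 'Z_2]%g| = 1%N by rewrite cards1.
have o2 : #|[set: 'Z_2]%SET| = 2%N by rewrite cardsT card_ord.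
have o4 : #|[set: 'Z_2 * 'Z_2]%SET| = 4%N by rewrite cardsT card_prod card_ord.
have o6 : #|[set: 'S_3]%SET| = 6%N by rewrite cardsT card_Sn.
have o12 : #|[set: 'D_12]%SET| = 12%N by exact: (@card_dihedral 6).
rewrite -gen1P -gen2P.
set C2 := exists2 al, _ & _; set C4 := exists2 p, _ & _.
pose C6 := W1 = gen [set refl eps1; refl eps2; refl (- eps3)].
have i1 : W1 = [set id] -> group_iso W1 [1 'Z_2]%g.
  by move=> ->; exact: trivial_iso.
have i2 : C2 -> group_iso W1 [set: 'Z_2]%SET.
  by move=> [al alP ->]; exact: gen1_iso.
have i4 : C4 -> group_iso W1 [set: 'Z_2 * 'Z_2]%SET.
  by move=> [p pP ->]; exact: gen2_iso.
have i6 : C6 -> group_iso W1 [set: 'S_3]%SET by move=> ->; exact: gen3_iso.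
have i12 : W1 = WG2 R -> group_iso W1 [set: 'D_12]%SET.
  by move=> ->; exact: WG2_iso.
have cls : (W1 = [set id] /\ ord 1%N) \/ (C2 /\ ord 2%N) \/ (C4 /\ ord 4%N) \/
    (C6 /\ ord 6%N) \/
    ((W1 = WG2 R /\ ~ integral_at (2 *: delta) lam) /\ ord 12%N).
  case: (Wint1_classified lam) => [C|C|C|[C|[C allI]]].
  - left; split; [exact: C | exact: ordI (i1 C) o1].
  - right; left; split; [exact: C | exact: ordI (i2 C) o2].
  - do 2!right; left; split; [exact: C | exact: ordI (i4 C) o4].
  - do 3!right; left; split; [exact: C | exact: ordI (i6 C) o6].
  - do 4!right; split; last exact: ordI (i12 C) o12.
    split; first exact: C.
    (* All the roots of G_2 are integral, so only 2delta can fail to be. *)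
    move=> I0; case: hnonint => ga; rewrite inE => /predU1P[->|gaP].
      by move/(_ I0).
    by move/(_ (allI _ gaP)).
have neq (k : nat) (gT : finGroupType) (H : {set gT}) :
    group_iso W1 H -> ord k -> #|H| <> k -> False.
  by move=> isoH ordk ne; exact: ne (ordk _ _ isoH).
split; last split; last split; last split; last split.
- case: cls => [[/i1 C _]|[[/i2 C _]|[[/i4 C _]|[[/i6 C _]|[[/i12 C _] _]]]]].
  + by left.
  + by right; left.
  + by do 2!right; left.
  + by do 3!right; left.
  + by do 4!right.
- split=> [W1id|Wid]; last first.
    by rewrite /W1 /Wint1 Wid setIidl // => _ ->; have [] := WG2_group R.
  rewrite Wint_Wint1 // => I0; have [al alI] := atypical_integral hatyp I0.
  exact: (Wint1_neq_id alI).
- split; last exact: i2.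
  move=> iso2; case: cls => [[_ oW]|[[C _]|[[_ oW]|[[_ oW]|[_ oW]]]]];
    first [exact: C | by case: (neq _ _ _ iso2 oW); rewrite o2].
- split; last exact: i4.
  move=> iso4; case: cls => [[_ oW]|[[_ oW]|[[C _]|[[_ oW]|[_ oW]]]]];
    first [exact: C | by case: (neq _ _ _ iso4 oW); rewrite o4].
- split; last exact: i6.
  move=> iso6; case: cls => [[_ oW]|[[_ oW]|[[_ oW]|[[C _]|[_ oW]]]]];
    first [exact: C | by case: (neq _ _ _ iso6 oW); rewrite o6].
- split=> [[W1G2 _]|WG2_].
    have iso12 := i12 W1G2.
    case: cls => [[_ oW]|[[_ oW]|[[_ oW]|[[_ oW]|[[_ nI] _]]]]];
      first [by rewrite (Wint_Wint1 nI)
            |by case: (neq _ _ _ iso12 oW); rewrite o12].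
  by split; [rewrite /W1 /Wint1 WG2_ setIid | exact: WG2_iso].
Qed.
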